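(* For every integer $d\geq1$, the cone $\mathcal{C}_{2,2d}=\mathrm{cone}\{\phi_{2,2d}(z):z\in\mathbb{R}^2\}\subset\mathbb{R}^{2d+1}$ over the homogeneous moment curve is Terracini convex, i.e., it is $k$-Terracini convex for all $k$.
   Context: $\phi_{2,2d}:\mathbb{R}^2\to\mathbb{R}^{2d+1}$ is the homogeneous moment map $\phi_{2,2d}(z)=(z_1^{\alpha_1}z_2^{\alpha_2})_{\alpha}$, indexed by $\alpha\in\mathbb{N}^2$ with $\alpha_1+\alpha_2=2d$; $\mathrm{cone}$ denotes the convex conic hull. For a closed, pointed ($\mathcal{C}\cap(-\mathcal{C})=\{0\}$), convex cone $\mathcal{C}$ and $x\in\mathcal{C}$, let $\mathcal{T}_{\mathcal{C}}(x)=\overline{\mathrm{cone}\{z-x:z\in\mathcal{C}\}}$ be the tangent cone and $\mathcal{L}_{\mathcal{C}}(x)=\mathcal{T}_{\mathcal{C}}(x)\cap(-\mathcal{T}_{\mathcal{C}}(x))$ the convex tangent space. $\mathcal{C}$ is $k$-Terracini convex if $\mathcal{L}_{\mathcal{C}}\big(\sum_{i=1}^kx^{(i)}\big)=\sum_{i=1}^k\mathcal{L}_{\mathcal{C}}(x^{(i)})$ for any collection $x^{(1)},\ldots,x^{(k)}$ of (not necessarily distinct) generators of extreme rays of $\mathcal{C}$. *)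

(* Defs.v *)
From HB Require Import structures.
From mathcomp Require Import all_boot all_order all_algebra.
From mathcomp Require Import all_classical all_reals all_analysis.

Set Implicit Arguments.
Unset Strict Implicit.
Unset Printing Implicit Defensive.

Import Order.TTheory GRing.Theory Num.Theory.
Import numFieldNormedType.Exports.

Local Open Scope classical_set_scope.
Local Open Scope ring_scope.

(* The empty combination (m = 0) is allowed, so 0 always belongs to the hull. *)
Definition conic_hull (R : realType) (V : normedModType R) (S : set V) : set V :=
  [set v | exists (m : nat) (c : 'I_m -> R) (s : 'I_m -> V),
      [/\ forall i, 0 <= c i, forall i, S (s i) & v = \sum_(i < m) c i *: s i]].

Definition opp_set (R : realType) (V : normedModType R) (A : set V) : set V :=
  [set - x | x in A].

Definition minkowski_sum (R : realType) (V : normedModType R) (k : nat)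
    (A : 'I_k -> set V) : set V :=
  [set v | exists2 y : 'I_k -> V, forall i, A i (y i) & v = \sum_(i < k) y i].

Record closed_pointed_convex_cone (R : realType) (V : normedModType R)
    (C : set V) : Prop := ClosedPointedConvexCone {
  cpcc_closed : closed C;
  cpcc_convex : convex_set C;
  cpcc_scale : forall (c : R) (x : V), 0 <= c -> C x -> C (c *: x);
  cpcc_pointed : C `&` opp_set C = [set 0]
}.

Definition tangent_cone (R : realType) (V : normedModType R) (C : set V) (x : V)
    : set V :=
  closure (conic_hull [set z - x | z in C]).

Definition convex_tangent_space (R : realType) (V : normedModType R)
    (C : set V) (x : V) : set V :=
  tangent_cone C x `&` opp_set (tangent_cone C x).

Definition ray (R : realType) (V : normedModType R) (x : V) : set V :=
  [set v | exists2 t : R, 0 <= t & v = t *: x].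

(* An extreme ray is a one-dimensional face: a ray contained in C such that
   two elements of C whose sum lies on the ray both lie on it. *)
Definition extreme_ray_generator (R : realType) (V : normedModType R)
    (C : set V) (x : V) : Prop :=
  [/\ x != 0, ray x `<=` C &
      forall y z : V, C y -> C z -> ray x (y + z) -> ray x y /\ ray x z].

(* The notion is only defined for closed pointed convex cones, so being one is
   part of the predicate. *)
Definition k_terracini_convex (R : realType) (V : normedModType R) (k : nat)
    (C : set V) : Prop :=
  closed_pointed_convex_cone C /\
  forall x : 'I_k -> V, (forall i, extreme_ray_generator C (x i)) ->
    convex_tangent_space C (\sum_(i < k) x i) =
    minkowski_sum (fun i => convex_tangent_space C (x i)).

Definition terracini_convex (R : realType) (V : normedModType R) (C : set V)
    : Prop :=
  forall k : nat, k_terracini_convex k C.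

(* Coordinate i is the monomial of exponent alpha = (i, 2d - i); these are
   exactly the alpha in N^2 with alpha_1 + alpha_2 = 2d. *)
Definition moment_map (R : realType) (d : nat) (z : 'rV[R]_2)
    : 'rV[R]_(2 * d + 1) :=
  \row_(i < 2 * d + 1) (z 0 0 ^+ i * z 0 1 ^+ (2 * d - i)).

Definition moment_curve_cone (R : realType) (d : nat) : set 'rV[R]_(2 * d + 1) :=
  conic_hull [set moment_map d z | z in [set: 'rV[R]_2]].

Arguments moment_curve_cone R d : clear implicits.

(* Main.v *)
Require Import Defs.
From HB Require Import structures.
From mathcomp Require Import all_boot all_order all_algebra.
From mathcomp Require Import all_classical all_reals all_analysis.
From mathcomp Require Import zify.

(** The moment cone [C] is closed and pointed because the form
    z1 ^ 2d + z2 ^ 2d is positive on the moment curve, and its extreme rays are generated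
    by points phi(z) of the curve. The key point is that the convex tangent
    space of [C] at a sum of points phi(z_i) is exactly the span of the
    tangent planes of phi at the z_i, which makes both sides of the
    Terracini identity agree. The span is contained in the tangent space by
    differentiating along the curve. Conversely, a binary form [s] of degree
    [d] vanishing at all the z_i gives a functional s^2 that is nonnegative
    on [C] and zero at the sum, hence zero on the tangent space; by
    polarization so is every product of two such forms. A form of degree 2d
    annihilating the tangent planes has a double zero at each z_i, so it is
    a sum of such products, and duality of subspaces concludes. *)

Set Implicit Arguments.
Unset Strict Implicit.
Unset Printing Implicit Defensive.

Import Order.TTheory GRing.Theory Num.Theory.
Import numFieldNormedType.Exports.

Local Open Scope classical_set_scope.
Local Open Scope ring_scope.

(** * Convex cones *)

Lemma cvg_matrix_entries (R : realType) (m n : nat) (T : Type)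
    (F : set_system T) (FF : Filter F) (f : T -> 'M[R]_(m, n))
    (M : 'M[R]_(m, n)) :
  (forall i j, f t i j @[t --> F] --> M i j) -> f t @[t --> F] --> M.
Proof.
move=> fM; apply/cvgrPdist_lt => e e0.
have : \forall t \near F, forall ij : 'I_m * 'I_n,
    `|M ij.1 ij.2 - f t ij.1 ij.2| < e.
  apply: filter_forall => -[i j] /=.
  by move/cvgrPdist_lt: (fM i j) => /(_ _ e0).
apply: filterS => t ft.
rewrite -[X in X < _]/(mx_norm _) mx_normrE.
by apply/bigmax_ltP; split => // -[i j] _ /=; rewrite !mxE; exact: (ft (i, j)).
Qed.

Lemma closure_cvg (T : topologicalType) (U : Type) (F : set_system U)
    (FF : ProperFilter F) (f : U -> T) (A : set T) (x : T) :
  (\forall u \near F, A (f u)) -> f u @[u --> F] --> x -> closure A x.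
Proof.
move=> FA fx B Bx; have /filter_ex[u [Au Bu]] :
  \forall u \near F, A (f u) /\ B (f u).
  by near=> u; split; near: u => //; exact: fx.
by exists (f u).
Unshelve. all: by end_near. Qed.

Section ConvexCones.
Variables (R : realType) (V : normedModType R).
Implicit Types (S C : set V) (x y : V).

Lemma conic_hull0 S : conic_hull S 0.
Proof. by exists 0, (fun=> 0), (fun=> 0); split=> [|[]|] //;
  rewrite big_ord0. Qed.

Lemma conic_hull_sub S : S `<=` conic_hull S.
Proof.
move=> x Sx; exists 1, (fun=> 1), (fun=> x); split=> //.
by rewrite big_ord1 scale1r.
Qed.

Lemma conic_hullD S x y : conic_hull S x -> conic_hull S y ->
  conic_hull S (x + y).
Proof.
move=> [m [c [s [c0 sS ->]]]] [m' [c' [s' [c'0 s'S ->]]]].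
pose glue T (f : 'I_m -> T) (g : 'I_m' -> T) (i : 'I_(m + m')) :=
  match fintype.split i with inl j => f j | inr j => g j end.
exists (m + m')%N, (glue _ c c'), (glue _ s s').
split=> [i|i|]; rewrite /glue; [by case: fintype.split|by case: fintype.split|].
rewrite big_split_ord; congr (_ + _); apply: eq_bigr => i _.
  by rewrite -[lshift _ _]/(unsplit (inl i)) unsplitK.
by rewrite -[rshift _ _]/(unsplit (inr i)) unsplitK.
Qed.

Lemma conic_hullZ S (a : R) x : 0 <= a -> conic_hull S x ->
  conic_hull S (a *: x).
Proof.
move=> a0 [m [c [s [c0 sS ->]]]]; exists m, (fun i => a * c i), s; split=> //.
  by move=> i; rewrite mulr_ge0.
by rewrite scaler_sumr; apply: eq_bigr => i _; rewrite scalerA.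
Qed.

Lemma conic_hull_mono S C : S `<=` C -> conic_hull S `<=` conic_hull C.
Proof. by move=> SC x [m [c [s [c0 sS ->]]]]; exists m, c, s; split=> // i;
  exact: SC. Qed.

Lemma closureD S x y : (forall u v, S u -> S v -> S (u + v)) ->
  closure S x -> closure S y -> closure S (x + y).
Proof.
move=> SD Sx Sy B /(@add_continuous V (x, y))[[/= P Q] [Px Qy] PQ].
have [u [Su Pu]] := Sx _ Px; have [v [Sv Qv]] := Sy _ Qy.
by exists (u + v); split; [exact: SD | exact: (PQ (u, v))].
Qed.

Lemma closureZ S (a : R) x : (forall u, S u -> S (a *: u)) ->
  closure S x -> closure S (a *: x).
Proof.
move=> SZ Sx B aB.
have [|u [Su Bu]] := Sx ((fun u => a *: u) @^-1` B).
  exact: (@scaler_continuous _ V a x).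
by exists (a *: u); split => //; exact: SZ.
Qed.

Lemma tangent_coneD C x u v :
  tangent_cone C x u -> tangent_cone C x v -> tangent_cone C x (u + v).
Proof. by apply: closureD => ? ?; exact: conic_hullD. Qed.

Lemma tangent_coneZ C x (a : R) u :
  0 <= a -> tangent_cone C x u -> tangent_cone C x (a *: u).
Proof. by move=> a0; apply: closureZ => ?; exact: conic_hullZ. Qed.

(** A generator [z - x] can be rewritten as [(z + y) - (x + y)], and [z + y] stays in [C]. *)
Lemma tangent_coneDr C x y : (forall u v, C u -> C v -> C (u + v)) -> C y ->
  tangent_cone C x `<=` tangent_cone C (x + y).
Proof.
move=> CD Cy; apply: closureS; apply: conic_hull_mono => _ [z Cz <-].
by exists (z + y); [exact: CD | rewrite opprD addrACA subrr addr0].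
Qed.

Lemma convex_tangent_spaceE C x u :
  convex_tangent_space C x u <-> tangent_cone C x u /\ tangent_cone C x (- u).
Proof.
split=> [[Tu [v Tv uv]]|[Tu TNu]]; first by rewrite -{2}uv opprK.
by split=> //; exists (- u) => //; rewrite opprK.
Qed.

Lemma convex_tangent_space0 C x : convex_tangent_space C x 0.
Proof.
by apply/convex_tangent_spaceE; rewrite oppr0; split;
  apply: subset_closure; exact: conic_hull0.
Qed.

Lemma convex_tangent_spaceD C x u v : convex_tangent_space C x u ->
  convex_tangent_space C x v -> convex_tangent_space C x (u + v).
Proof.
move=> /convex_tangent_spaceE[Tu TNu] /convex_tangent_spaceE[Tv TNv].
by apply/convex_tangent_spaceE; rewrite opprD; split; exact: tangent_coneD.
Qed.

Lemma convex_tangent_spaceZ C x (a : R) u : convex_tangent_space C x u ->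
  convex_tangent_space C x (a *: u).
Proof.
move=> /convex_tangent_spaceE[Tu TNu]; apply/convex_tangent_spaceE.
case: (leP 0 a) => [a0|/ltW a0].
  by rewrite -scalerN; split; exact: tangent_coneZ.
(* A negative scalar exchanges the two memberships, of [u] and of [- u]. *)
rewrite -scaleNr -[a *: u]opprK -scaleNr -scalerN.
split; apply: tangent_coneZ; rewrite ?oppr_ge0 ?opprK //.
Qed.

Lemma convex_tangent_space_sub_add C x y : (forall u v, C u -> C v ->
  C (u + v)) ->
  C y -> convex_tangent_space C x `<=` convex_tangent_space C (x + y).
Proof.
move=> CD Cy u /convex_tangent_spaceE[Tu TNu].
by apply/convex_tangent_spaceE; split; exact: tangent_coneDr.
Qed.

(** A supporting hyperplane at [x] also supports the tangent cone: [f (z - x) = f z] on generators,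
    and the half-space where [f] is nonnegative is closed. *)
Lemma tangent_cone_ge0 C x (f : V -> R) :
  continuous f -> linear_for *%R f -> (forall z, C z -> 0 <= f z) -> f x = 0 ->
  forall u, tangent_cone C x u -> 0 <= f u.
Proof.
move=> fc fl fC fx u Tu.
pose g : {linear V -> R^o} := HB.pack f (GRing.isLinear.Build _ _ _ _ f fl).
have Cf : closed [set u | 0 <= f u].
  by apply: (@preimage_closed _ _ f [set r | 0 <= r]) => //; exact: closed_ge.
suff : [set w | 0 <= f w] u by [].
rewrite [X in X u]((closure_id [set w | 0 <= f w]).1 Cf).
apply: closureS Tu => _ [m [c [s [c0 sS ->]]]] /=.
rewrite -[f _]/(g _) linear_sum sumr_ge0// => i _.
rewrite linearZ /= mulr_ge0 //; have [z Cz <-] := sS i.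
have -> : f (z - x) = f z - f x by exact: (linearB g).
by rewrite fx subr0 fC.
Qed.

(** Subtracting from [c] the largest multiple of the relation [lam] that keeps all coefficients
    nonnegative makes one of them zero. This happens at the index [i0] minimizing [c i / lam i] over
    positive [lam i], and that term is dropped. *)
Lemma caratheodory_step (m : nat) (s : 'I_m.+1 -> V) (c lam : 'I_m.+1 -> R) :
  (forall i, 0 <= c i) -> \sum_i lam i *: s i = 0 -> (exists i, 0 < lam i) ->
  exists (i0 : 'I_m.+1) (c' : 'I_m -> R), (forall i, 0 <= c' i) /\
  \sum_i c i *: s i = \sum_i c' i *: s (lift i0 i).
Proof.
move=> c0 lams [i1 i1p].
have [i0 i0p imin] := (@arg_minP _ _ _ i1 (fun i => 0 < lam i)) (fun i => c i /
  lam i) i1p.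
pose c' i := c i - c i0 / lam i0 * lam i.
have c'i0 : c' i0 = 0 by rewrite /c' divfK ?subrr// gt_eqF.
have c'ge i : 0 <= c' i.
  rewrite subr_ge0; case: (ltP 0 (lam i)) => li.
    by rewrite -ler_pdivlMr// imin.
  by rewrite (le_trans _ (c0 i))// mulr_ge0_le0// divr_ge0// ltW.
exists i0, (c' \o lift i0); split=> [i|]; first exact: c'ge.
transitivity (\sum_i c' i *: s i).
  under [RHS]eq_bigr do rewrite scalerBl -scalerA.
  by rewrite sumrB -scaler_sumr lams scaler0 subr0.
rewrite (bigD1_ord i0) //= c'i0 scale0r add0r.
by apply: eq_bigr.
Qed.

End ConvexCones.

(** Carathéodory's theorem for cones, by induction on the number of terms. The assumption [S 0]
    allows short combinations to be padded to exactly [n] terms. *)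
Lemma conic_caratheodory (R : realType) (n : nat) (S : set 'rV[R]_n) (v :
  'rV[R]_n) :
  S 0 -> conic_hull S v ->
  exists (c : 'I_n -> R) (s : 'I_n -> 'rV[R]_n),
    [/\ forall i, 0 <= c i, forall i, S (s i) & v = \sum_i c i *: s i].
Proof.
move=> S0 [m]; elim: m v => [|m IH] v [c [s [c0 sS ->]]].
  exists (fun=> 0), (fun=> 0); split=> //; rewrite big_ord0 big1// => i _.
  by rewrite scaler0.
case: (leqP m.+1 n) => [mn|nm].
  (* Indices beyond [m] are sent to [None] and receive coefficient 0 and vector 0. *)
  pose e (i : 'I_n) : option 'I_m.+1 := insub (val i).
  exists (fun i => oapp c 0 (e i)), (fun i => oapp s 0 (e i)).
  split=> [i|i|]; [by case: (e i)|by case: (e i)|].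
  pose F i := oapp c 0 (insub i) *: oapp s 0 (insub i : option 'I_m.+1).
  rewrite -[RHS](big_mkord xpredT F) (big_cat_nat _ (n := m.+1))//=.
  rewrite [X in _ + X]big_nat [X in _ + X]big1 ?addr0.
    rewrite big_mkord; apply: eq_bigr => i _; rewrite /F valK //.
  by move=> i /andP[mi _]; rewrite /F insubN ?scale0r// -leqNgt.
(* More vectors than the dimension: the rows of [M] satisfy a nontrivial relation [u], whose sign is
   then chosen so that some coefficient is positive. *)
pose M := \matrix_(i < m.+1) s i.
have [u uM u0] : exists2 u : 'rV_m.+1, u *m M = 0 & u != 0.
  have /rowV0Pn[u /sub_kermxP uM u0] : kermx M != 0.
    rewrite kermx_eq0 /row_free neq_ltn; apply/orP; left.
    by rewrite (leq_ltn_trans (rank_leq_col M)).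
  by exists u.
have us : \sum_i u 0 i *: s i = 0.
  transitivity (u *m M) => //; rewrite mulmx_sum_row.
  by apply: eq_bigr => i _; rewrite rowK.
have [lam lams lamp] : exists2 lam : 'I_m.+1 -> R,
    \sum_i lam i *: s i = 0 & exists i, 0 < lam i.
  have /rV0Pn[i ui] := u0.
  case: (ltP 0 (u 0 i)) => [up|un]; first by exists (u 0) => //; exists i.
  exists (fun i => - u 0 i); last by exists i; rewrite oppr_gt0 lt_neqAle ui.
  by under eq_bigr do rewrite scaleNr; rewrite sumrN us oppr0.
have [i0 [c' [c'0 ->]]] := caratheodory_step c0 lams lamp.
by apply: IH; exists c', (fun i => s (lift i0 i)); split.
Qed.

(** * The cone over the moment curve *)

Definition moment_vec (R : realType) (d : nat) (a b : R) : 'rV[R]_(2 * d + 1) :=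
  \row_i (a ^+ i * b ^+ (2 * d - i)).

Lemma range_moment_map (R : realType) (d : nat) (v : 'rV[R]_(2 * d + 1)) :
  [set moment_map d z | z in [set: 'rV[R]_2]] v <->
  exists a b, v = moment_vec d a b.
Proof.
split=> [[z _ <-]|[a [b ->]]]; first by exists (z 0 0), (z 0 1).
exists (\row_i (if i == 0 then a else b)) => //.
by apply/rowP => i; rewrite !mxE.
Qed.

Lemma exp2d_ge0 (R : realType) (d : nat) (a : R) : 0 <= a ^+ (2 * d).
Proof. by rewrite exprM exprn_ge0// sqr_ge0. Qed.

Lemma exists_root (R : realType) (n : nat) (c : R) : (0 < n)%N -> 0 <= c ->
  exists2 r : R, 0 <= r & r ^+ n = c.
Proof.
move=> n0 c0; exists (c `^ n%:R^-1); first exact: powR_ge0.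
rewrite -powR_mulrn ?powR_ge0// -powRrM mulVf ?powRr1//.
by rewrite pnatr_eq0 -lt0n.
Qed.

Section MomentCone.
Variables (R : realType) (d : nat).
Hypothesis hd : (1 <= d)%N.
Local Notation C := (moment_curve_cone R d).
Local Notation V := 'rV[R]_(2 * d + 1).

Lemma le_2d (i : 'I_(2 * d + 1)) : (i <= 2 * d)%N.
Proof. by rewrite -ltnS -(addn1 (2 * d)). Qed.

Lemma moment_vecZ (r a b : R) : moment_vec d (r * a) (r * b) = r ^+ (2 * d) *:
  moment_vec d a b.
Proof.
apply/rowP => i; rewrite !mxE !exprMn.
by rewrite mulrACA -exprD subnKC// le_2d.
Qed.

Lemma moment_vec00 : moment_vec d 0 0 = 0 :> V.
Proof.
rewrite -[X in moment_vec _ X _](mul0r 0) -[X in moment_vec _ _ X](mul0r 0).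
by rewrite moment_vecZ expr0n muln_eq0 (gtn_eqF hd) scale0r.
Qed.

(** A nonnegative scalar is a [2 * d]-th power, so homogeneity absorbs it into the point. *)
Lemma scale_moment_vec (c a b : R) : 0 <= c ->
  exists a' b', c *: moment_vec d a b = moment_vec d a' b'.
Proof.
move=> c0; have [|r r0 <-] := @exists_root R (2 * d) c _ c0;
  first by rewrite muln_gt0.
by exists (r * a), (r * b); rewrite moment_vecZ.
Qed.

Lemma moment_cone_vec (a b : R) : C (moment_vec d a b).
Proof. by apply: conic_hull_sub; apply/range_moment_map; exists a, b. Qed.

Lemma moment_cone_sum (n : nat) (a b : 'I_n -> R) :
  C (\sum_i moment_vec d (a i) (b i)).
Proof.
apply: (big_ind C) => [|v w|i _]; [exact: conic_hull0|exact: conic_hullD|].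
exact: moment_cone_vec.
Qed.

(** Carathéodory's theorem bounds the number of terms and scaling removes the coefficients. Having a
    fixed number of summands is what makes the compactness argument for closedness possible. *)
Lemma moment_coneP (v : V) : C v -> exists (a b : 'I_(2 * d + 1) -> R),
  v = \sum_i moment_vec d (a i) (b i).
Proof.
have S0 : [set moment_map d z | z in [set: 'rV[R]_2]] 0.
  by apply/range_moment_map; exists 0, 0; rewrite moment_vec00.
move=> /(conic_caratheodory S0)[c [s [c0 sS ->]]].
have H i : exists ab : R * R, c i *: s i = moment_vec d ab.1 ab.2.
  have /range_moment_map[a [b ->]] := sS i.
  by have [a' [b' ->]] := scale_moment_vec a b (c0 i); exists (a', b').
have [f fE] := choice H.
by exists (fst \o f), (snd \o f); apply: eq_bigr => i _; rewrite fE.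
Qed.

Lemma ltn_02d : (0 < 2 * d + 1)%N. Proof. by rewrite addn1. Qed.
Lemma ltn_2d : (2 * d < 2 * d + 1)%N. Proof. by rewrite addn1. Qed.

(* The form [z1 ^ 2d + z2 ^ 2d], positive on the cone minus the origin. *)
Definition height (v : V) : R := v 0 (Ordinal ltn_02d) + v 0 (Ordinal ltn_2d).

Lemma heightD (v w : V) : height (v + w) = height v + height w.
Proof. by rewrite /height !mxE addrACA. Qed.

Lemma height_vec (a b : R) : height (moment_vec d a b) = a ^+ (2 * d) + b ^+ (2
  * d).
Proof. by rewrite /height !mxE /= subn0 subnn !expr0 mul1r mulr1 addrC. Qed.

Lemma height_sum (n : nat) (a b : 'I_n -> R) :
  height (\sum_i moment_vec d (a i) (b i)) = \sum_i (a i ^+ (2 * d) + b i ^+ (2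
    * d)).
Proof.
rewrite (big_morph height heightD (id1 := 0)) ?/height ?mxE ?addr0//.
by apply: eq_bigr => i _; rewrite -height_vec.
Qed.

Lemma height_le_norm (v : V) : height v <= `|v| *+ 2.
Proof.
have H i : v 0 i <= `|v|.
  rewrite -[X in _ <= X]/(mx_norm v) mx_normrE.
  apply: (le_trans (ler_norm _)).
  exact: (le_bigmax _ (fun ij : 'I_1 * 'I__ => `|v ij.1 ij.2|) (0, i)).
by rewrite mulr2n lerD.
Qed.

Lemma norm_le_of_expr (x B : R) : 1 <= B -> x ^+ (2 * d) <= B -> `|x| <= B.
Proof.
move=> B1 xB; case: (leP `|x| 1) => [x1|/ltW x1]; first exact: le_trans B1.
rewrite (le_trans _ xB)// -[X in _ <= X]ger0_norm ?exp2d_ge0// normrX.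
by rewrite ler_eXnr// muln_gt0.
Qed.

Lemma sum_moment_vec_continuous (n : nat) :
  continuous (fun ab : 'rV[R]_n * 'rV[R]_n => \sum_i moment_vec d (ab.1 0 i)
    (ab.2 0 i)).
Proof.
move=> ab; apply: cvg_matrix_entries => i j.
under eq_fun do rewrite summxE; rewrite summxE.
apply: cvg_big => [|k _]; first exact: add_continuous.
under eq_fun do rewrite mxE; rewrite mxE.
have c1 : (fun x : 'rV[R]_n * 'rV[R]_n => x.1 0 k) x @[x --> ab] --> ab.1 0 k.
  apply: (@continuous_comp _ _ _ fst (fun v : 'rV[R]_n => v 0 k)).
    exact: cvg_fst.
  exact: coord_continuous.
have c2 : (fun x : 'rV[R]_n * 'rV[R]_n => x.2 0 k) x @[x --> ab] --> ab.2 0 k.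
  apply: (@continuous_comp _ _ _ snd (fun v : 'rV[R]_n => v 0 k)).
    exact: cvg_snd.
  exact: coord_continuous.
by apply: cvgM; [exact: (cvg_comp _ _ c1 (@exprn_continuous R j _)) |
  exact: (cvg_comp _ _ c2 (@exprn_continuous R _ _))].
Qed.

(* Near a given point, [height] confines the summands of [moment_coneP] to a
   compact set. *)
Lemma moment_cone_closed : closed C.
Proof.
move=> v Cv.
(* [B] bounds [height] on the unit ball around [v], since [height w] is at most twice the norm of
   [w]. *)
pose B := (`|v| + 1) *+ 2.
have B1 : 1 <= B by rewrite /B mulr2n ler_wpDl ?addr_ge0// ler_wpDl.
pose box := [set a : 'rV[R]_(2 * d + 1) | forall i, [set` `[- B, B]] (a ord0
  i)].
pose f (ab : V * V) := \sum_i moment_vec d (ab.1 0 i) (ab.2 0 i).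
pose K := f @` (box `*` box).
have KC : K `<=` C by move=> _ [ab _ <-]; exact: moment_cone_sum.
have cK : closed K.
  apply: compact_closed; first exact: norm_hausdorff.
  apply: continuous_compact; first
    exact/continuous_subspaceT/sum_moment_vec_continuous.
  have cbox : compact box by apply: (@rV_compact _ _ (fun=> [set` `[- B, B]]))
    => i; exact: segment_compact.
  exact: compact_setX.
(* As [K] is closed, it suffices that [v] is in its closure; neighborhoods of [v] are cut down to
   the unit ball, where points of [C] have all their summands in the box. *)
apply: KC; rewrite ((closure_id K).1 cK) => U Uv.
have [|w [Cw [Uw]]] := Cv (U `&` ball v 1).
  by apply: filterI => //; exact: (nbhsx_ballx v 1 ltr01).
rewrite -ball_normE /= => vw; exists w; split=> //.
have [a [b wE]] := moment_coneP Cw.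
have hw : height w <= B.
  rewrite (le_trans (height_le_norm w))// lerMn2r /= -lerBlDl.
  by rewrite (le_trans (lerB_dist _ _))// distrC ltW.
have ab i : a i ^+ (2 * d) + b i ^+ (2 * d) <= B.
  apply: le_trans hw; rewrite wE height_sum (bigD1 i)//= lerDl sumr_ge0// => j
    _.
  by rewrite addr_ge0// exp2d_ge0.
exists (\row_i a i, \row_i b i); last first.
  by rewrite /f wE; apply: eq_bigr => i _; rewrite !mxE.
split=> i; rewrite /= in_itv /= -ler_norml mxE norm_le_of_expr//;
  apply: le_trans (ab i).
  by rewrite lerDl exp2d_ge0.
by rewrite lerDr exp2d_ge0.
Qed.

(** If [v] and [- v] lie in the cone, their heights are nonnegative with sum 0. The height of [v] is
    a sum of even powers, so every point in its decomposition is the origin. *)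
Lemma moment_cone_pointed : C `&` opp_set C = [set 0].
Proof.
apply/seteqP; split=> [v [Cv [w Cw wv]]|_ ->]; last first.
  by split; [|exists 0; rewrite ?oppr0//]; exact: conic_hull0.
have [a [b vE]] := moment_coneP Cv; have [a' [b' wE]] := moment_coneP Cw.
have h_ge0 n (x y : 'I_n -> R) : 0 <= \sum_i (x i ^+ (2 * d) + y i ^+ (2 * d)).
  by apply: sumr_ge0 => i _; rewrite addr_ge0// exp2d_ge0.
have : height v + height w = 0 by rewrite -heightD -wv addNr /height !mxE addr0.
move/eqP; rewrite wE vE !height_sum paddr_eq0 ?h_ge0// => /andP[/eqP hv _].
rewrite /= big1// => i _.
have := hv; move=> /eqP; rewrite psumr_eq0; last by move=> j _;
  rewrite addr_ge0// exp2d_ge0.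
move=> /allP/(_ i (mem_index_enum _)) /=.
rewrite paddr_eq0 ?exp2d_ge0// !expf_eq0 => /andP[/andP[_ /eqP ->] /andP[_ /eqP
  ->]].
exact: moment_vec00.
Qed.

Lemma moment_cone_cpcc : closed_pointed_convex_cone C.
Proof.
split; [exact: moment_cone_closed| |by move=> *;
  exact: conic_hullZ|exact: moment_cone_pointed].
move=> x y l; rewrite !in_setE => Cx Cy.
have l0 : 0 <= l%:num by exact: ge0.
have l1 : 0 <= 1 - l%:num :> R by rewrite subr_ge0 le1.
exact: (conic_hullD (conic_hullZ l0 Cx) (conic_hullZ l1 Cy)).
Qed.

(** Split a nonzero curve point off a decomposition of [x]. Extremality puts it on the ray of [x],
    so [x] is a positive multiple of it and hence again a curve point. *)
Lemma extreme_ray_generator_moment (x : V) : extreme_ray_generator C x ->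
  exists a b, x = moment_vec d a b /\ ((a != 0) || (b != 0)).
Proof.
move=> [x0 xC xE].
have Cx : C x by apply: xC; exists 1; rewrite ?scale1r.
have [a [b E]] := moment_coneP Cx.
have [i vi0] : exists i, moment_vec d (a i) (b i) != 0.
  apply/existsP; move: x0; apply: contraNT; rewrite negb_exists => /forallP H.
  by rewrite E big1// => i _; apply/eqP; move: (H i); rewrite negbK.
have [|||[t t0 tE] _] := xE (moment_vec d (a i) (b i)) (\sum_(j | j != i)
  moment_vec d (a j) (b j)).
- exact: moment_cone_vec.
- apply: (big_ind C) => [|v w|j _]; [exact: conic_hull0|exact: conic_hullD|].
  exact: moment_cone_vec.
- by exists 1 => //; rewrite scale1r E [RHS](bigD1 i).
have t'0 : t != 0 by apply: contra_neq vi0 => t'0; rewrite tE t'0 scale0r.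
have tx : x = t^-1 *: moment_vec d (a i) (b i) by rewrite tE scalerA mulVf//
  scale1r.
have [|a' [b' E']] := @scale_moment_vec t^-1 (a i) (b i);
  first by rewrite invr_ge0.
exists a', b'; rewrite tx E'; split=> //.
move: x0; rewrite tx E'; apply: contraNT;
  rewrite negb_or !negbK => /andP[/eqP-> /eqP->].
by rewrite moment_vec00.
Qed.

End MomentCone.

(** * Derivatives and binary forms *)

(** Difference quotients lie in the cone of directions for [t > 0], and their negatives do for
    [t < 0]; the two one-sided limits give [u] and [- u]. *)
Lemma convex_tangent_space_curve (R : realType) (V : normedModType R) (C :
  set V)
    (h : R -> V) (a : R) (u : V) : (forall t, C (h t)) ->
  t^-1 *: (h (t + a) - h a) @[t --> 0^'] --> u -> convex_tangent_space C (h a)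
    u.
Proof.
move=> Ch hu; apply/convex_tangent_spaceE; rewrite /tangent_cone; split.
  apply: (closure_cvg _ _ (cvg_dnbhs_at_right hu)).
  near=> t; apply: conic_hullZ; first by rewrite invr_ge0 ltW//; near: t;
    exact: nbhs_right_gt.
  by apply: conic_hull_sub; exists (h (t + a)).
apply: (closure_cvg _ _ (cvgN (cvg_dnbhs_at_left hu))).
near=> t; rewrite /= -scaleNr; apply: conic_hullZ.
  by rewrite oppr_ge0 invr_le0 ltW//; near: t; exact: nbhs_left_lt.
by apply: conic_hull_sub; exists (h (t + a)).
Unshelve. all: by end_near. Qed.

Lemma horner_cvg_deriv (R : realType) (p : {poly R}) (a : R) :
  t^-1 * (p.[t + a] - p.[a]) @[t --> 0^'] --> p^`().[a].
Proof.
have /cvg_ex[l hl] := @derivable_horner R p a.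
have <- : l = p^`().[a] by rewrite derivE derive1E; exact/esym/(cvg_lim _ hl).
apply: cvg_trans hl; apply: near_eq_cvg; near=> t.
by rewrite /= /shift /= [t%:A]mulr1.
Unshelve. all: by end_near. Qed.

Lemma sum_poly_wide (R : nzRingType) (n : nat) (p : {poly R}) :
  (size p <= n)%N ->
  p = \sum_(i < n) p`_i *: 'X^i.
Proof.
move=> sp; rewrite -poly_def; apply/polyP => i; rewrite coef_poly.
by case: ltnP => // ni; rewrite nth_default// (leq_trans sp).
Qed.

(** The squares of ['X - r%:P] for distinct [r] are pairwise coprime, so it is enough that each
    divides [p]. *)
Lemma dvdp_prod_XsubC_sqr (F : fieldType) (p : {poly F}) (rs : seq F) :
  uniq rs -> {in rs, forall r, root p r && root p^`() r} ->
  (\prod_(r <- rs) ('X - r%:P)) ^+ 2 %| p.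
Proof.
elim: rs => [|r rs IH] /=; first by rewrite big_nil expr1n dvd1p.
move=> /andP[rrs urs] rP; rewrite big_cons exprMn.
rewrite Gauss_dvdp; last first.
  rewrite coprimep_expl// coprimep_expr// coprimep_sym coprimep_XsubC.
  by rewrite root_prod_XsubC.
rewrite IH ?andbT//; last by move=> x xrs; apply: rP; rewrite inE xrs orbT.
(* Writing [p = q * ('X - r%:P)], the derivative of [p] at [r] equals [q.[r]], so [r] is also a root
   of [q]. *)
have /andP[/factor_theorem[q pE]] := rP r (mem_head _ _).
rewrite pE derivM derivXsubC mulr1 /root !hornerE subrr mulr0 add0r.
by move=> /factor_theorem[q' ->]; rewrite -mulrA -expr2 dvdp_mull.
Qed.

Section HomogeneousForm.
Variable R : fieldType.
Implicit Types (p q : {poly R}) (n m : nat) (a b : R).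

(* The binary form of degree [n] with dehomogenization [p]. *)
Definition hform n p a b : R := \sum_(i < n + 1) p`_i * (a ^+ i * b ^+ (n - i)).

Lemma hformE n p a b : (size p <= n + 1)%N -> b != 0 ->
  hform n p a b = b ^+ n * p.[a / b].
Proof.
move=> sp b0; rewrite (horner_coef_wide _ sp) mulr_sumr; apply: eq_bigr => i _.
have ni : (i <= n)%N by rewrite -ltnS -(addn1 n).
rewrite [RHS]mulrCA; congr (_ * _).
by rewrite expr_div_n -[X in b ^+ X * (_ / _)](subnK ni) exprD -mulrA [b ^+ i *
  _]mulrC divfK ?expf_neq0// mulrC.
Qed.

Lemma hform_inf n p a : hform n p a 0 = p`_n * a ^+ n.
Proof.
rewrite /hform addn1 big_ord_recr /= subnn mulr1 big1 ?add0r// => i _.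
by rewrite expr0n subn_eq0 leqNgt ltn_ord !mulr0.
Qed.

(** The case [b = 0] is the point at infinity, where a zero of the form means a drop in the degree
    of [p]. *)
Lemma hform_eq0 n p a b : (size p <= n + 1)%N -> (b != 0 -> root p (a / b)) ->
  (b = 0 -> (size p <= n)%N) -> hform n p a b = 0.
Proof.
move=> sp p1 p2; have [b0|b0] := eqVneq b 0.
  by rewrite b0 hform_inf nth_default ?mul0r// p2.
by rewrite hformE// (rootP (p1 b0)) mulr0.
Qed.

Lemma hformM n p q a b : (size p <= n + 1)%N -> (size q <= n + 1)%N ->
  hform (2 * n) (p * q) a b = hform n p a b * hform n q a b.
Proof.
move=> sp sq; have [->|b0] := eqVneq b 0; last first.
  rewrite !hformE//; first by rewrite hornerM mul2n -addnn exprD mulrACA.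
  rewrite (leq_trans (size_polyMleq _ _))//.
  by move: sp sq; lia.
rewrite !hform_inf mul2n -addnn exprD mulrACA; congr (_ * _).
(* At infinity only the coefficient of index [2 * n] counts, and by the size bounds its only
   surviving term is the product of the coefficients of index [n]. *)
rewrite coefM (bigD1 (inord n)) //= inordK ?ltnS ?leq_addl//.
rewrite addnK big1 ?addr0// => i; rewrite -val_eqE /= inordK ?ltnS ?leq_addl//
  => ni.
case: (ltngtP i n) ni => // ni _.
  rewrite [X in _ * X]nth_default ?mulr0// (leq_trans sq)// addn1.
  by rewrite ltn_subRL addnC ltn_add2l.
by rewrite nth_default ?mul0r// (leq_trans sp)// addn1.
Qed.

End HomogeneousForm.

(** * Tangent spaces of the moment cone *)

Section TangentSpace.
Variables (R : realType) (d : nat).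
Hypothesis hd : (1 <= d)%N.
Local Notation C := (moment_curve_cone R d).
Local Notation V := 'rV[R]_(2 * d + 1).

(** The linear functional on moment vectors given by the form of degree [2 * d] with
    dehomogenization [p]; on the curve it evaluates that form. *)
Definition form_pair (p : {poly R}) (v : V) : R :=
  \sum_(i < 2 * d + 1) p`_i * v 0 i.

Lemma form_pair_linear (p : {poly R}) : linear_for *%R (form_pair p).
Proof.
move=> c v w; rewrite /form_pair mulr_sumr -big_split /=; apply: eq_bigr => i _.
by rewrite !mxE mulrDr mulrCA.
Qed.

Lemma form_pairDl (p q : {poly R}) (v : V) :
  form_pair (p + q) v = form_pair p v + form_pair q v.
Proof. by rewrite -big_split; apply: eq_bigr => i _; rewrite coefD mulrDl. Qed.

Lemma form_pairZl (c : R) (p : {poly R}) (v : V) :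
  form_pair (c *: p) v = c * form_pair p v.
Proof. by rewrite mulr_sumr; apply: eq_bigr => i _; rewrite coefZ mulrA. Qed.

Lemma form_pair0l (v : V) : form_pair 0 v = 0.
Proof. by rewrite /form_pair big1// => i _; rewrite coef0 mul0r. Qed.

Lemma form_pair_sumr (p : {poly R}) (I : finType) (F : I -> V) :
  form_pair p (\sum_i F i) = \sum_i form_pair p (F i).
Proof.
rewrite /form_pair exchange_big; apply: eq_bigr => j _ /=.
by rewrite summxE mulr_sumr.
Qed.

Lemma form_pair_continuous (p : {poly R}) : continuous (form_pair p).
Proof.
move=> v; have Fv := nbhs_filter v; apply: (cvg_big _ Fv) => [|i _];
  first exact: add_continuous.
apply: cvgM; last exact: coord_continuous.
exact: (@cvg_cst R p`_i _ (nbhs v) (nbhs_filter v)).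
Qed.

Lemma form_pair_moment_vec (p : {poly R}) (a b : R) :
  form_pair p (moment_vec d a b) = hform (2 * d) p a b.
Proof. by apply: eq_bigr => i _; rewrite mxE. Qed.

(** The partial derivatives of the moment map in its two variables. Where a truncated predecessor
    occurs at 0, the multiplicity is 0 as well. *)
Definition moment_deriv1 (a b : R) : V :=
  \row_i (a ^+ i.-1 *+ i * b ^+ (2 * d - i)).
Definition moment_deriv2 (a b : R) : V :=
  \row_i (a ^+ i * (b ^+ (2 * d - i).-1 *+ (2 * d - i))).

(* Together with [moment_vec d a b] it spans both partial derivatives of the
   moment map, by Euler's relation. *)
Definition moment_deriv (a b : R) : V :=
  if b == 0 then moment_deriv2 a b else moment_deriv1 a b.

Lemma form_pair_deriv1 (p : {poly R}) (a b : R) : (size p <= 2 * d + 1)%N ->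
  b != 0 -> form_pair p (moment_deriv1 a b) = b ^+ (2 * d).-1 * p^`().[a / b].
Proof.
move=> sp b0; rewrite {2}(sum_poly_wide sp) raddf_sum /= horner_sum mulr_sumr.
apply: eq_bigr => -[i /= ilt] _; rewrite mxE derivZ derivXn /= hornerZ hornerMn
  hornerXn.
rewrite [RHS]mulrCA; congr (_ * _); case: i ilt => [|i] ilt;
  first by rewrite !mulr0n mul0r mulr0.
rewrite /= mulrnAl mulrnAr; congr (_ *+ _).
have -> : (2 * d).-1 = (2 * d - i.+1 + i)%N by lia.
by rewrite expr_div_n exprD -mulrA [b ^+ i * _]mulrC divfK ?expf_neq0// mulrC.
Qed.

(** At [b = 0] only the coordinate of index [2 * d - 1] survives, so this pairing detects a double
    zero at infinity. *)
Lemma form_pair_deriv2_inf (p : {poly R}) (a : R) :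
  form_pair p (moment_deriv2 a 0) = p`_(2 * d).-1 * a ^+ (2 * d).-1.
Proof.
have h : ((2 * d).-1 < 2 * d + 1)%N by lia.
rewrite /form_pair (bigD1 (Ordinal h)) //= mxE /=.
have -> : (2 * d - (2 * d).-1 = 1)%N by lia.
rewrite mulr1 big1 ?addr0// => -[i /= ilt] ine.
have {}ine : i != (2 * d).-1 by [].
rewrite mxE /= expr0n; case: (ltngtP i (2 * d)) => [ilt2|i2|->].
- have -> : ((2 * d - i).-1 == 0)%N = false by lia.
  by rewrite mul0rn !mulr0.
- by lia.
- by rewrite subnn mulr0n !mulr0.
Qed.

(** * Tangent directions at a point of the curve *)

Lemma tangent_moment_vec (a b : R) :
  convex_tangent_space C (moment_vec d a b) (moment_vec d a b).
Proof.
have Cv := moment_cone_vec d a b.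
(* With [x] the curve point, [x] is [(x + x) - x] and [- x] is [0 - x]. *)
apply/convex_tangent_spaceE; split; apply/subset_closure/conic_hull_sub.
  by exists (moment_vec d a b + moment_vec d a b);
    [exact: conic_hullD|rewrite addrK].
by exists 0; [exact: conic_hull0|rewrite sub0r].
Qed.

Lemma tangent_moment_deriv1 (a b : R) :
  convex_tangent_space C (moment_vec d a b) (moment_deriv1 a b).
Proof.
apply: (@convex_tangent_space_curve _ _ _ (fun t => moment_vec d t b)) => [t|].
  exact: moment_cone_vec.
apply: cvg_matrix_entries => i j; rewrite ord1.
pose p : {poly R} := b ^+ (2 * d - j) *: 'X^j.
have -> : moment_deriv1 a b 0 j = p^`().[a].
  by rewrite mxE derivZ derivXn hornerZ hornerMn hornerXn mulrC.
apply: cvg_trans (@horner_cvg_deriv R p a); apply: near_eq_cvg; near=> t.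
by rewrite !mxE /p !hornerZ !hornerXn ![b ^+ _ * _]mulrC.
Unshelve. all: by end_near. Qed.

Lemma tangent_moment_deriv2 (a b : R) :
  convex_tangent_space C (moment_vec d a b) (moment_deriv2 a b).
Proof.
apply: (@convex_tangent_space_curve _ _ _ (fun t => moment_vec d a t)) => [t|].
  exact: moment_cone_vec.
apply: cvg_matrix_entries => i j; rewrite ord1.
pose p : {poly R} := a ^+ j *: 'X^(2 * d - j).
have -> : moment_deriv2 a b 0 j = p^`().[b].
  by rewrite mxE derivZ derivXn hornerZ hornerMn hornerXn.
apply: cvg_trans (@horner_cvg_deriv R p b); apply: near_eq_cvg; near=> t.
by rewrite !mxE /p !hornerZ !hornerXn.
Unshelve. all: by end_near. Qed.

Lemma tangent_moment_deriv (a b : R) :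
  convex_tangent_space C (moment_vec d a b) (moment_deriv a b).
Proof.
rewrite /moment_deriv; case: eqP => _; first exact: tangent_moment_deriv2.
exact: tangent_moment_deriv1.
Qed.

(** * Upper bound on the tangent space by duality *)

Section Annihilator.
Variables (k : nat) (a b : 'I_k -> R) (v : V).
Hypothesis ab0 : forall i, (a i != 0) || (b i != 0).
Hypothesis vL : convex_tangent_space C (\sum_i moment_vec d (a i) (b i)) v.

Lemma form_pair_sqr_eq0 (s : {poly R}) : (size s <= d + 1)%N ->
  (forall i, hform d s (a i) (b i) = 0) -> form_pair (s * s) v = 0.
Proof.
move=> ss s0; have /convex_tangent_spaceE[Tv TNv] := vL.
have ge0 : forall u, tangent_cone C (\sum_i moment_vec d (a i) (b i)) u ->
    0 <= form_pair (s * s) u.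
  apply: tangent_cone_ge0; [exact: form_pair_continuous|exact:
    form_pair_linear| |].
    move=> z /(moment_coneP hd)[x [y ->]]; rewrite form_pair_sumr sumr_ge0// =>
      i _.
    by rewrite form_pair_moment_vec hformM// -expr2 sqr_ge0.
  rewrite form_pair_sumr big1// => i _.
  by rewrite form_pair_moment_vec hformM// s0 mul0r.
(* Both [v] and [- v] lie in the tangent cone, so the value has both signs. *)
apply/eqP; rewrite eq_le ge0// andbT -oppr_ge0.
have -> : - form_pair (s * s) v = form_pair (s * s) (- v).
  by rewrite /form_pair -sumrN; apply: eq_bigr => i _; rewrite mxE mulrN.
exact: ge0.
Qed.

(** Polarization: [2 * s * t] is the square of [s + t] minus the squares of [s] and [t]. *)
Lemma form_pair_mul_eq0 (s t : {poly R}) :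
  (size s <= d + 1)%N -> (size t <= d + 1)%N ->
  (forall i, hform d s (a i) (b i) = 0) ->
    (forall i, hform d t (a i) (b i) = 0) ->
  form_pair (s * t) v = 0.
Proof.
move=> ss st s0 t0.
have := @form_pair_sqr_eq0 (s + t).
rewrite mulrDl !mulrDr [t * s]mulrC !form_pairDl (form_pair_sqr_eq0 ss s0)
  (form_pair_sqr_eq0 st t0).
rewrite add0r addr0 -mulr2n => H; apply/eqP.
rewrite -[_ == 0](mulrn_eq0 _ 2) H// => [|i].
  by rewrite (leq_trans (size_polyD _ _))// geq_max ss.
rewrite -(s0 i) -[RHS]addr0 -(t0 i) /hform -big_split /=.
by apply: eq_bigr => j _; rewrite coefD mulrDl.
Qed.

(* Such a form is the square of the product of the linear forms vanishing at the
   distinct points [a i : b i] times a form of even degree, hence a combination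
   of products of two forms of degree [d] vanishing at these points. *)
Lemma form_pair_double_zeros_eq0 (p : {poly R}) : (size p <= 2 * d + 1)%N ->
  (forall i, form_pair p (moment_vec d (a i) (b i)) = 0) ->
  (forall i, form_pair p (moment_deriv (a i) (b i)) = 0) -> form_pair p v = 0.
Proof.
move=> sp p0 dp0.
pose rs := undup [seq a i / b i | i <- enum 'I_k & b i != 0].
have rsP i : b i != 0 -> a i / b i \in rs.
  by move=> bi; rewrite mem_undup; apply: map_f; rewrite mem_filter bi mem_enum.
pose inf := [exists i, b i == 0].
(* The degree left to the dehomogenization of a form of degree [d] once it vanishes at infinity, if
   infinity is among the points. *)
pose e := (d - inf)%N.
have infP i : b i = 0 -> e.+1 = d.
  move=> bi; have -> : e = d.-1; last by rewrite prednK.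
  by rewrite /e (_ : inf = true) ?subn1//; apply/existsP; exists i; rewrite bi.
(* A double zero at infinity removes the two top coefficients of [p]. *)
have spe : (size p <= 2 * e + 1)%N.
  rewrite /e; case: (boolP inf) => [/existsP[i /eqP bi]|_];
    last by rewrite subn0.
  have ai : a i != 0 by have := ab0 i; rewrite bi eqxx orbF.
  have /eqP := p0 i; rewrite bi form_pair_moment_vec hform_inf mulf_eq0
    expf_eq0 (negbTE ai) andbF orbF => /eqP p2d.
  have /eqP := dp0 i; rewrite /moment_deriv bi eqxx form_pair_deriv2_inf
    mulf_eq0 expf_eq0 (negbTE ai) andbF orbF => /eqP p2d1.
  apply/leq_sizeP => j jd; case: (ltngtP j (2 * d)) => [jlt|jgt|->//].
    by rewrite (_ : j = (2 * d).-1)//; move: jd jlt hd => /=; lia.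
  by rewrite nth_default// (leq_trans sp)//; lia.
pose G : {poly R} := \prod_(r <- rs) ('X - r%:P).
have Gp : G ^+ 2 %| p.
  apply: dvdp_prod_XsubC_sqr; first exact: undup_uniq.
  move=> r; rewrite mem_undup => /mapP[i]; rewrite mem_filter => /andP[bi _] ->.
  have := p0 i; rewrite form_pair_moment_vec hformE// => /eqP.
  rewrite mulf_eq0 expf_eq0 (negbTE bi) andbF /= => p1; rewrite /root p1 /=.
  have := dp0 i; rewrite /moment_deriv (negbTE bi) form_pair_deriv1// => /eqP.
  by rewrite mulf_eq0 expf_eq0 (negbTE bi) andbF.
have [->|pn0] := eqVneq p 0; first exact: form_pair0l.
have /dvdpP[q pE] := Gp.
have sG : size G = (size rs).+1 by rewrite size_prod_XsubC.
have G0 : G != 0 by rewrite -size_poly_gt0 sG.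
have qn0 : q != 0 by apply: contra_neq pn0 => q0; rewrite pE q0 mul0r.
have sq : (size q + 2 * size rs <= 2 * e + 1)%N.
  move: spe; rewrite pE expr2 size_mul ?mulf_neq0// size_mul// sG.
  by move: (size q) (size rs) => x y; lia.
have sq0 : (0 < size q)%N by rewrite size_poly_gt0.
have [f ef] : exists f, e = (f + size rs)%N.
  by exists (e - size rs)%N; lia.
have sqf : (size q <= 2 * f + 1)%N by lia.
pose s n : {poly R} := 'X^n * G.
have sP n : (n <= f)%N -> (size (s n) <= e + 1)%N.
  move=> nf; apply: leq_trans (size_polyMleq _ _) _.
  by rewrite size_polyXn sG addSn addnS /= ef addn1 ltnS leq_add2r.
have sd n : (n <= f)%N -> (size (s n) <= d + 1)%N.
  by move=> nf; rewrite (leq_trans (sP _ nf))// leq_add2r leq_subr.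
have s0 n : (n <= f)%N -> forall i, hform d (s n) (a i) (b i) = 0.
  move=> nf i; apply: hform_eq0 => [|bi|bi]; first exact: sd.
    by rewrite rootM root_prod_XsubC rsP ?orbT.
  by rewrite (leq_trans (sP _ nf))// addn1 (infP i).
rewrite pE {1}(sum_poly_wide sqf) mulr_suml.
apply: (big_ind (fun r => form_pair r v = 0)) => [|x y x0 y0|i _].
- exact: form_pair0l.
- by rewrite form_pairDl x0 y0 addr0.
(* An exponent up to [2 * f] splits into two exponents up to [f], so ['X^i * G ^+ 2] is
   [s m * s n]. *)
have [m [n [-> mf nf]]] : exists m n, [/\ (i :
  nat) = (m + n)%N, (m <= f)%N & (n <= f)%N].
  by exists (minn i f), (i - minn i f)%N; have := ltn_ord i; split; lia.
rewrite -scalerAl form_pairZl exprD expr2 mulrACA form_pair_mul_eq0 ?mulr0//;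
  by [exact: sd|exact: s0].
Qed.

(** A vector killed by every functional that vanishes on a subspace belongs to it; here the subspace
    is the row space of [A] and [B] together. *)
Lemma convex_tangent_space_moment_sum_sub : exists x y : 'I_k -> R,
  v = \sum_i (x i *: moment_vec d (a i) (b i) + y i *: moment_deriv (a i) (b
    i)).
Proof.
pose A := \matrix_i moment_vec d (a i) (b i).
pose B := \matrix_i moment_deriv (a i) (b i).
have rA i : row i A = moment_vec d (a i) (b i) by rewrite rowK.
have rB i : row i B = moment_deriv (a i) (b i) by rewrite rowK.
have : (v <= A + B)%MS.
  rewrite addsmxE submxE; apply/eqP/rowP => j; rewrite [RHS]mxE.
  set K := cokermx _.
  (* Column [j] of the cokernel, a functional vanishing on the rows of [A] and [B], is read as a
     form of degree [2 * d]. *)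
  pose p : {poly R} := \poly_(i < 2 * d + 1) oapp (K^~ j) 0 (insub i).
  have pE (w : V) : form_pair p w = (w *m K) 0 j.
    rewrite mxE; apply: eq_bigr => i _.
    by rewrite coef_poly ltn_ord valK /= mulrC.
  have : A *m K = 0 /\ B *m K = 0.
    by apply/eq_col_mx; rewrite -mul_col_mx mulmx_coker col_mx0.
  move=> [AK BK].
  rewrite -pE form_pair_double_zeros_eq0 ?size_poly// => i.
    by rewrite pE -rA -row_mul AK !mxE.
  by rewrite pE -rB -row_mul BK !mxE.
move=> /sub_addsmxP[[x y] /= ->]; exists (x 0), (y 0).
rewrite !mulmx_sum_row -big_split; apply: eq_bigr => i _ /=.
by rewrite rA rB.
Qed.

End Annihilator.

End TangentSpace.

(** * The two inclusions of the Terracini identity *)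

Theorem corollary3p16 (R : realType) (d : nat) (hd : (1 <= d)%N) :
  terracini_convex (moment_curve_cone R d).
Proof.
move=> k; split=> [|x xE]; first exact: moment_cone_cpcc.
have CD : forall u v, moment_curve_cone R d u -> moment_curve_cone R d v ->
    moment_curve_cone R d (u + v) by move=> u v; exact: conic_hullD.
have /choice[z zE] i : exists z : R * R,
    x i = moment_vec d z.1 z.2 /\ ((z.1 != 0) || (z.2 != 0)).
  by have [a [b ab]] := extreme_ray_generator_moment hd (xE i); exists (a, b).
have -> : x = (fun i => moment_vec d (z i).1 (z i).2).
  by apply/funext => i; have [] := zE i.
have z0 i : ((z i).1 != 0) || ((z i).2 != 0) by have [] := zE i.
apply/seteqP; split=> [v vL|_ [y yL ->]].
  have [p [q ->]] := convex_tangent_space_moment_sum_sub hd z0 vL.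
  exists (fun i => p i *: moment_vec d (z i).1 (z i).2 +
                   q i *: moment_deriv d (z i).1 (z i).2) => // i.
  apply: convex_tangent_spaceD; apply: convex_tangent_spaceZ.
    exact: tangent_moment_vec.
  exact: tangent_moment_deriv.
apply: (big_ind (convex_tangent_space _ _)) => [|v w|i _].
- exact: convex_tangent_space0.
- exact: convex_tangent_spaceD.
(* The remaining summands lie in the cone, and adding them to the base point only enlarges the
   tangent space. *)
- rewrite (bigD1 i) //=; apply: convex_tangent_space_sub_add (yL i) => //.
  apply: (big_ind (moment_curve_cone R d)) => [||j _];
    [exact: conic_hull0|exact: CD|].
  exact: moment_cone_vec.
Qed.
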